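(* Let $n$ be a positive integer. For every idempotent $Q\in\mathbb{C}^{n\times n}$ and every projection $P\in\mathbb{C}^{n\times n}$, we have $$\|P-Q\|_F\le \|I_n-m(Q)-Q\|_F,$$ where $m(Q)$ is the matched projection of $Q$. Moreover, equality occurs only if $P=I_n-m(Q)$.
   Context: An idempotent is a matrix $Q$ with $Q^2=Q$; a projection is a Hermitian idempotent ($P=P^*=P^2$). $\|\cdot\|_F$ is the Frobenius norm, $I_n$ the identity matrix, $A^*$ the conjugate transpose, $A^\dag$ the Moore-Penrose inverse, and $|A|=(A^*A)^{1/2}$ the positive semi-definite square root, so $|Q^*|=(QQ^* )^{1/2}$. For an idempotent $Q\in\mathbb{C}^{n\times n}$ the matched projection is $$m(Q)=\tfrac12\big(|Q^*|+Q^*\big)\,|Q^*|^\dag\,\big(|Q^*|+I_n\big)^{-1}\big(|Q^*|+Q\big),$$ which is known to be a projection. *)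

(* Defs.v *)
From HB Require Import structures.
From mathcomp Require Import all_boot all_order all_algebra.
From mathcomp Require Import sesquilinear spectral.
From mathcomp Require Import boolp classical_sets reals.
From mathcomp Require Import ring.
From mathcomp Require Export complex.

Set Implicit Arguments.
Unset Strict Implicit.
Unset Printing Implicit Defensive.

Import Order.TTheory GRing.Theory Num.Theory.
Local Open Scope ring_scope.
Local Open Scope sesquilinear_scope.

(* A numClosedFieldType C carries the partial order of the complex numbers:
   0 <= z means that z is real and nonnegative.  Norms are C-valued, and
   M ^t* is the conjugate transpose. *)
Section MatchedProjection.
Variable C : numClosedFieldType.

Definition idempotent_mx n (Q : 'M[C]_n) : Prop := Q *m Q = Q.

Definition projection_mx n (P : 'M[C]_n) : Prop :=
  P ^t* = P /\ P *m P = P.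

Definition frobenius_norm m n (A : 'M[C]_(m, n)) : C :=
  sqrtC (\sum_i \sum_j `|A i j| ^+ 2).

Definition psdmx n (A : 'M[C]_n) : Prop :=
  A ^t* = A /\ forall x : 'cV[C]_n, 0 <= (x ^t* *m A *m x) 0 0.

Definition is_psd_sqrt n (A S : 'M[C]_n) : Prop := psdmx S /\ S *m S = A.

(* Meaningful for A positive semi-definite: see psd_sqrtP and
   is_psd_sqrt_unique. *)
Definition psd_sqrt n (A : 'M[C]_n) : 'M[C]_n :=
  xget 0 [set S | is_psd_sqrt A S]%classic.

Definition absmx m n (A : 'M[C]_(m, n)) : 'M[C]_n := psd_sqrt (A ^t* *m A).

(* The four Penrose equations. *)
Definition is_mp_inverse m n (A : 'M[C]_(m, n)) (X : 'M[C]_(n, m)) : Prop :=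
  [/\ A *m X *m A = A, X *m A *m X = X,
      (A *m X) ^t* = A *m X & (X *m A) ^t* = X *m A].

(* Total: see mp_inverseP and is_mp_inverse_unique. *)
Definition mp_inverse m n (A : 'M[C]_(m, n)) : 'M[C]_(n, m) :=
  xget 0 [set X | is_mp_inverse A X]%classic.

Definition matched_projection n (Q : 'M[C]_n) : 'M[C]_n :=
  2^-1 *: ((absmx (Q ^t*) + Q ^t*) *m mp_inverse (absmx (Q ^t*))
             *m invmx (absmx (Q ^t*) + 1%:M) *m (absmx (Q ^t*) + Q)).

Lemma trmxC_mul m n p (A : 'M[C]_(m, n)) (B : 'M[C]_(n, p)) :
  (A *m B) ^t* = B ^t* *m A ^t*.
Proof. by rewrite trmx_mul map_mxM. Qed.

Lemma gram_diagE m n (A : 'M[C]_(m, n)) j :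
  (A ^t* *m A) j j = \sum_i `|A i j| ^+ 2.
Proof. by rewrite mxE; apply: eq_bigr => i _; rewrite !mxE mulrC normCK. Qed.

Lemma gram_eq0 m n (A : 'M[C]_(m, n)) : A ^t* *m A = 0 -> A = 0.
Proof.
move=> A0; apply/matrixP => i j; rewrite mxE; apply/eqP.
have /eqP := gram_diagE A j; rewrite A0 mxE eq_sym psumr_eq0; last first.
  by move=> k _; rewrite exprn_ge0.
by move=> /allP/(_ i (mem_index_enum _)); rewrite sqrf_eq0 normr_eq0.
Qed.

Lemma psdmx_gram m n (A : 'M[C]_(m, n)) : psdmx (A ^t* *m A).
Proof.
split=> [|x]; first by rewrite trmxC_mul trmxCK.
rewrite mulmxA -trmxC_mul -mulmxA gram_diagE.
by apply: sumr_ge0 => i _; rewrite exprn_ge0.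
Qed.

Lemma quad_diag m n (M : 'M[C]_n) (X : 'M[C]_(n, m)) j :
  (X ^t* *m M *m X) j j = ((col j X) ^t* *m M *m col j X) 0 0.
Proof.
rewrite !mxE; apply: eq_bigr => k _; rewrite !mxE; congr (_ * _).
by apply: eq_bigr => l _; rewrite !mxE.
Qed.

Lemma psdmx_sqrt_exists n (A : 'M[C]_n) : psdmx A -> exists S, is_psd_sqrt A S.
Proof.
move=> [Ah A0].
have An : A \is normalmx by apply/normalmxP; rewrite Ah.
have [Uu /esym AE] := (spectral_unitarymx A, orthomx_spectralP An).
set U := spectralmx A in Uu AE; set d := spectral_diag A in AE.
rewrite invmx_unitary // in AE.
have UU : U *m U ^t* = 1%:M by apply/unitarymxP.
have d0 i : 0 <= d 0 i.
  have := A0 (col i (U ^t*)).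
  rewrite -quad_diag trmxCK -AE !mulmxA UU mul1mx -mulmxA UU mulmx1.
  by rewrite mxE eqxx mulr1n.
pose s := \row_i sqrtC (d 0 i).
exists (U ^t* *m diag_mx s *m U); split.
  pose r := \row_i sqrtC (s 0 i).
  have s0 i : 0 <= s 0 i by rewrite mxE sqrtC_ge0.
  rewrite (_ : _ *m U = (diag_mx r *m U) ^t* *m (diag_mx r *m U)).
    exact: psdmx_gram.
  rewrite trmxC_mul !mulmxA; congr (_ *m _); rewrite -mulmxA; congr (_ *m _).
  rewrite tr_diag_mx map_diag_mx mulmx_diag; congr diag_mx.
  apply/rowP => i; rewrite !mxE [_^* * _]mulrC -normCK.
  by rewrite ger0_norm ?sqrtCK // !sqrtC_ge0.
rewrite !mulmxA -(mulmxA _ U) UU mulmx1 -[in RHS]AE; congr (_ *m _).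
rewrite -mulmxA mulmx_diag; congr (_ *m diag_mx _).
by apply/rowP => i; rewrite !mxE -expr2 sqrtCK.
Qed.

Lemma psd_sqrtP n (A : 'M[C]_n) : psdmx A -> is_psd_sqrt A (psd_sqrt A).
Proof.
move=> /psdmx_sqrt_exists[S AS].
exact: (@xgetPex _ 0 [set S | is_psd_sqrt A S]%classic (ex_intro _ S AS)).
Qed.

Lemma psdmx_ker n m (S : 'M[C]_n) (X : 'M[C]_(n, m)) :
  psdmx S -> (forall j, (X ^t* *m S *m X) j j = 0) -> S *m X = 0.
Proof.
move=> /psdmx_sqrt_exists[T [[Th _] <-]] XTX.
suff TX0 : T *m X = 0 by rewrite -mulmxA TX0 mulmx0.
apply/matrixP => i j; rewrite [RHS]mxE; apply/eqP.
have := XTX j; rewrite -{1}Th mulmxA -trmxC_mul -mulmxA gram_diagE.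
move=> /eqP; rewrite psumr_eq0; last by move=> k _; rewrite exprn_ge0.
by move=> /allP/(_ i (mem_index_enum _)); rewrite sqrf_eq0 normr_eq0.
Qed.

Lemma is_psd_sqrt_unique n (A S T : 'M[C]_n) :
  is_psd_sqrt A S -> is_psd_sqrt A T -> S = T.
Proof.
move=> [Sp SA] [Tp TA]; have [[Sh _] [Th _]] := (Sp, Tp).
have ST : S *m S = T *m T by rewrite SA.
pose D := S - T.
have Dh : D ^t* = D by rewrite /D linearB /= map_mxB Sh Th.
have ge0 (M : 'M[C]_n) j : psdmx M -> 0 <= (D ^t* *m M *m D) j j.
  by move=> [_ Mp]; rewrite quad_diag.
have tr0 : \tr (D ^t* *m S *m D) + \tr (D ^t* *m T *m D) = 0.
  rewrite -linearD /= -mulmxDl -mulmxDr Dh /D.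
  rewrite !(mulmxDr, mulmxBr, mulmxDl, mulmxBl, mulNmx, mulmxN).
  have trN (M : 'M[C]_n) : \tr (- M) = - \tr M by exact: linearN.
  rewrite !(mxtraceD, trN).
  have E1 : \tr (S *m T *m S) = \tr (T *m T *m T).
    by rewrite mxtrace_mulC mulmxA ST.
  have E2 : \tr (S *m T *m T) = \tr (S *m S *m S).
    by rewrite -[S *m T *m T]mulmxA -ST mulmxA.
  have E3 : \tr (T *m S *m S) = \tr (T *m T *m T).
    by rewrite -[T *m S *m S]mulmxA ST mulmxA.
  have E4 : \tr (T *m S *m T) = \tr (S *m S *m S).
    by rewrite mxtrace_mulC mulmxA -ST.
  have E5 : \tr (S *m S *m T) = \tr (T *m T *m T) by rewrite ST.
  have E6 : \tr (T *m T *m S) = \tr (S *m S *m S) by rewrite ST.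
  rewrite E1 E2 E3 E4 E5 E6.
  by ring.
have ker0 M : psdmx M -> \tr (D ^t* *m M *m D) = 0 -> M *m D = 0.
  move=> Mp tM; apply: psdmx_ker => // j; apply/eqP; move/eqP: tM.
  rewrite psumr_eq0; last by move=> k _; exact: ge0.
  by move=> /allP/(_ j (mem_index_enum _)).
have trge0 M : psdmx M -> 0 <= \tr (D ^t* *m M *m D).
  by move=> Mp; apply: sumr_ge0 => i _; exact: ge0.
move/eqP: tr0; rewrite paddr_eq0 ?trge0 // => /andP[/eqP trS /eqP trT].
have SD := ker0 _ Sp trS; have TD := ker0 _ Tp trT.
have DD : D ^t* *m D = 0 by rewrite Dh {1}/D mulmxBl SD TD subr0.
by apply/eqP; rewrite -subr_eq0; apply/eqP; exact: gram_eq0 DD.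
Qed.

Lemma absmxP m n (A : 'M[C]_(m, n)) : is_psd_sqrt (A ^t* *m A) (absmx A).
Proof. by apply: psd_sqrtP; exact: psdmx_gram. Qed.

Lemma is_mp_inverse_unique m n (A : 'M[C]_(m, n)) (X Y : 'M[C]_(n, m)) :
  is_mp_inverse A X -> is_mp_inverse A Y -> X = Y.
Proof.
move=> [AXA XAX AXh XAh] [AYA YAY AYh YAh].
have AXAY : A *m X = A *m Y.
  rewrite -{1}AYA -mulmxA -{1}AXh -{1}AYh -trmxC_mul mulmxA -[RHS]AYh.
  by rewrite AXA.
have XAYA : X *m A = Y *m A.
  have : (X *m A) *m (Y *m A) = X *m A.
    by rewrite -!mulmxA [A *m (Y *m A)]mulmxA AYA.
  rewrite -{1}XAh -{1}YAh -trmxC_mul -[Y *m A *m _]mulmxA [A *m (X *m A)]mulmxA.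
  by rewrite AXA YAh.
by rewrite -XAX -mulmxA AXAY mulmxA XAYA YAY.
Qed.

Lemma gram_unit m n (B : 'M[C]_(m, n)) :
  row_free (B ^t*) -> B ^t* *m B \in unitmx.
Proof.
move=> Bf; rewrite -row_free_unit -kermx_eq0; apply/eqP.
set K := kermx _.
have KB : K *m B ^t* = 0.
  suff : (K *m B ^t*) ^t* = 0.
    by move=> /(congr1 (fun M => M ^t*)); rewrite trmxCK trmx0 map_mx0.
  apply: gram_eq0; rewrite trmxCK [in X in _ *m X]trmxC_mul trmxCK.
  by rewrite mulmxA -[K *m _ *m B]mulmxA mulmx_ker mul0mx.
by apply: (row_free_inj Bf); rewrite KB mul0mx.
Qed.

Lemma mp_inverse_factor m n r (B : 'M[C]_(m, r)) (F : 'M[C]_(r, n)) :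
  B ^t* *m B \in unitmx -> F *m F ^t* \in unitmx ->
  is_mp_inverse (B *m F)
    (F ^t* *m invmx (F *m F ^t*) *m (invmx (B ^t* *m B) *m B ^t*)).
Proof.
move=> GB GF.
have hermV k (M : 'M[C]_k) : (invmx M) ^t* = invmx (M ^t*).
  by rewrite trmx_inv map_invmx.
pose Fr := F ^t* *m invmx (F *m F ^t*); pose Bl := invmx (B ^t* *m B) *m B ^t*.
have FFr : F *m Fr = 1%:M by rewrite mulmxA mulmxV.
have BlB : Bl *m B = 1%:M by rewrite -mulmxA mulVmx.
have FrFh : (Fr *m F) ^t* = Fr *m F.
  by rewrite !trmxC_mul hermV trmxC_mul trmxCK mulmxA.
have BBlh : (B *m Bl) ^t* = B *m Bl.
  by rewrite !trmxC_mul hermV trmxC_mul trmxCK mulmxA.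
rewrite -/Fr -/Bl.
have AX : B *m F *m (Fr *m Bl) = B *m Bl.
  by rewrite mulmxA -(mulmxA B) FFr mulmx1.
have XA : Fr *m Bl *m (B *m F) = Fr *m F.
  by rewrite mulmxA -(mulmxA Fr) BlB mulmx1.
split; rewrite ?AX ?XA //.
  by rewrite mulmxA -(mulmxA B) BlB mulmx1.
by rewrite mulmxA -(mulmxA Fr) FFr mulmx1.
Qed.

Lemma mp_inverse_exists m n (A : 'M[C]_(m, n)) : exists X, is_mp_inverse A X.
Proof.
rewrite -(mulmx_base A); eexists; apply: mp_inverse_factor.
  apply: gram_unit; rewrite row_free_map /row_free mxrank_tr.
  exact: col_base_full.
rewrite -{1}[row_base A]trmxCK; apply: gram_unit; rewrite trmxCK.
exact: row_base_free.
Qed.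

Lemma mp_inverseP m n (A : 'M[C]_(m, n)) : is_mp_inverse A (mp_inverse A).
Proof.
have [X AX] := mp_inverse_exists A.
exact: (@xgetPex _ 0 [set X | is_mp_inverse A X]%classic (ex_intro _ X AX)).
Qed.

Lemma psdmx_add1_unit n (A : 'M[C]_n) : psdmx A -> A + 1%:M \in unitmx.
Proof.
move=> [Ah A0]; rewrite -row_free_unit -kermx_eq0; apply/eqP.
set K := kermx _; suff : K ^t* = 0.
  by move=> /(congr1 (fun M => M ^t*)); rewrite trmxCK trmx0 map_mx0.
have : K *m A *m K ^t* + K *m K ^t* = 0.
  by rewrite -mulmxDl -{2}[K]mulmx1 -mulmxDr mulmx_ker mul0mx.
move=> KE; apply/matrixP => i j; rewrite [RHS]mxE; apply/eqP.
have := congr1 (fun M : 'M_n => M j j) KE; rewrite /= mxE [RHS]mxE.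
rewrite -{1 3}[K]trmxCK quad_diag gram_diagE => /eqP.
have ge0 : forall k, true -> 0 <= `|K ^t* k j| ^+ 2.
  by move=> k _; rewrite exprn_ge0.
rewrite paddr_eq0 ?sumr_ge0 // => /andP[_]; rewrite psumr_eq0 //.
by move=> /allP/(_ i (mem_index_enum _)); rewrite sqrf_eq0 normr_eq0.
Qed.

End MatchedProjection.

(* Main.v *)
Require Import Defs.
From mathcomp Require Import all_boot all_order all_algebra.
From mathcomp Require Import reals complex.
From mathcomp Require Import sesquilinear ring.

Import Order.TTheory GRing.Theory Num.Theory.
Local Open Scope ring_scope.
Local Open Scope complex_scope.

(* Expanding the square gives ||P - Q||^2 = ||Q||^2 - tr (H P) with
   H = Q + Q^* - 1, so that tr (H P) has to be minimized over the projections.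
   With S = |Q^*|, G = (S + 1)^-1, V = S + Q, M = m(Q) and N = 1 - M, one has
   H M = (V^* G V) / 2 >= 0 and - H N = 2 N S N + N > 0 on the range of N, i.e.
   N is the spectral projection of H for its negative eigenvalues, and
   tr (H P) - tr (H N) = tr (P (H M) P) + tr ((1 - P) (- H N) (1 - P)) >= 0. *)

(** * Adjoints, traces of Gram matrices and the Frobenius norm *)

Section Adjoint.
Local Open Scope sesquilinear_scope.
Variable C : numClosedFieldType.

Lemma trmxCD m n (A B : 'M[C]_(m, n)) : (A + B) ^t* = A ^t* + B ^t*.
Proof. by rewrite linearD map_mxD. Qed.

Lemma trmxCB m n (A B : 'M[C]_(m, n)) : (A - B) ^t* = A ^t* - B ^t*.
Proof. by rewrite linearB map_mxB. Qed.

Lemma trmxC1 n : (1%:M : 'M[C]_n) ^t* = 1%:M.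
Proof. by rewrite trmx1 map_mx1. Qed.

Lemma trmxC_inv n (A : 'M[C]_n) : (invmx A) ^t* = invmx (A ^t*).
Proof. by rewrite trmx_inv map_invmx. Qed.

Lemma mxtrace_gram_ge0 m n (A : 'M[C]_(m, n)) : 0 <= \tr (A ^t* *m A).
Proof.
apply: sumr_ge0 => j _; rewrite gram_diagE.
by apply: sumr_ge0 => i _; rewrite exprn_ge0.
Qed.

Lemma mxtrace_gram_eq0 m n (A : 'M[C]_(m, n)) : \tr (A ^t* *m A) = 0 -> A = 0.
Proof.
move=> /eqP; rewrite psumr_eq0 => [/allP tr0|j _]; last first.
  by rewrite gram_diagE sumr_ge0 // => i _; rewrite exprn_ge0.
apply/matrixP => i j; rewrite [RHS]mxE; apply/eqP.
have := tr0 j (mem_index_enum _); rewrite gram_diagE psumr_eq0 => [/allP|k _].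
  by move=> /(_ i (mem_index_enum _)); rewrite sqrf_eq0 normr_eq0.
by rewrite exprn_ge0.
Qed.

Lemma mxtrace_psd_ge0 m n (S : 'M[C]_n) (X : 'M[C]_(n, m)) :
  psdmx S -> 0 <= \tr (X ^t* *m S *m X).
Proof. by move=> [_ S0]; apply: sumr_ge0 => j _; rewrite quad_diag. Qed.

(** The product of [A *m B] with its own adjoint vanishes. This carries identities over from
    [S *m S = Q *m Q ^t*] to [S] and to [Q]. *)
Lemma mulmx_gram_eq0 m n p (A : 'M[C]_(m, n)) (B : 'M[C]_(n, p)) :
  A *m (B *m B ^t*) = 0 -> A *m B = 0.
Proof.
move=> AB0; have : (A *m B) ^t* = 0.
  by apply: gram_eq0; rewrite trmxCK trmxC_mul mulmxA -[_ *m B *m _]mulmxA AB0 mul0mx.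
by move=> /(congr1 (fun X => X ^t*)); rewrite trmxCK trmx0 map_mx0.
Qed.

Lemma frobenius_norm_ge0 m n (A : 'M[C]_(m, n)) : 0 <= frobenius_norm A.
Proof.
by rewrite sqrtC_ge0; do 2![apply: sumr_ge0 => ? _]; rewrite exprn_ge0.
Qed.

Lemma frobenius_norm_sqr m n (A : 'M[C]_(m, n)) :
  frobenius_norm A ^+ 2 = \tr (A ^t* *m A).
Proof.
rewrite sqrtCK exchange_big; apply: eq_bigr => j _.
by rewrite gram_diagE.
Qed.

(** Since [P ^t* *m P = P], the quadratic term is linear in [P] and contributes the [1%:M] inside
    the trace. *)
Lemma frobenius_norm_projB n (P Q : 'M[C]_n) : projection_mx P ->
  frobenius_norm (P - Q) ^+ 2 =
    \tr (Q ^t* *m Q) - \tr ((Q + Q ^t* - 1%:M) *m P).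
Proof.
move=> [Ph PP]; rewrite frobenius_norm_sqr trmxCB Ph.
rewrite !(mulmxBl, mulmxBr, mulmxDl) PP mul1mx !linearB /= linearD /=.
by rewrite (mxtrace_mulC P); ring.
Qed.

Lemma is_mp_inverse_trmxC m n (A : 'M[C]_(m, n)) (X : 'M[C]_(n, m)) :
  is_mp_inverse A X -> is_mp_inverse (A ^t*) (X ^t*).
Proof.
case=> AXA XAX AXh XAh; split; rewrite -!trmxC_mul ?mulmxA ?AXA ?XAX //.
  by rewrite XAh.
by rewrite AXh.
Qed.

(** By uniqueness, Moore-Penrose inversion commutes with adjoints; the third Penrose equation then
    becomes commutation. *)
Lemma mp_inverse_herm_comm n (S : 'M[C]_n) : S ^t* = S ->
  (mp_inverse S) ^t* = mp_inverse S /\ S *m mp_inverse S = mp_inverse S *m S.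
Proof.
move=> Sh; have SP := mp_inverseP S.
have Th : (mp_inverse S) ^t* = mp_inverse S.
  by apply: (is_mp_inverse_unique _ SP); rewrite -{1}Sh; apply: is_mp_inverse_trmxC.
by split=> //; case: SP => _ _ <- _; rewrite trmxC_mul Th Sh.
Qed.

End Adjoint.

(** * The modulus of the adjoint of [Q], its pseudoinverse [T] and the inverse [G] *)

Section MatchedProjection.
Local Open Scope sesquilinear_scope.
Variables (C : numClosedFieldType) (n : nat) (Q : 'M[C]_n).
Hypothesis hQ : idempotent_mx Q.

Let S := absmx (Q ^t*).
Let T := mp_inverse S.
Let G : 'M[C]_n := invmx (S + 1%:M).
Let V : 'M[C]_n := S + Q.
Let M := matched_projection Q.
Let N : 'M[C]_n := 1%:M - M.
Let H : 'M[C]_n := Q + Q ^t* - 1%:M.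

Let Spsd : psdmx S. Proof. by case: (absmxP (Q ^t*)). Qed.
Let Sh : S ^t* = S. Proof. by case: Spsd. Qed.
Let SS : S *m S = Q *m Q ^t*.
Proof. by case: (absmxP (Q ^t*)) => _; rewrite trmxCK. Qed.
Let Th : T ^t* = T. Proof. by case: (mp_inverse_herm_comm _ _ _ Sh). Qed.
Let ST : S *m T = T *m S. Proof. by case: (mp_inverse_herm_comm _ _ _ Sh). Qed.
Let STS : S *m T *m S = S. Proof. by case: (mp_inverseP S). Qed.

Let SG : (S + 1%:M) *m G = 1%:M. Proof. exact/mulmxV/psdmx_add1_unit. Qed.
Let GS : G *m (S + 1%:M) = 1%:M. Proof. exact/mulVmx/psdmx_add1_unit. Qed.
Let Gh : G ^t* = G. Proof. by rewrite trmxC_inv trmxCD trmxC1 Sh. Qed.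

Let G_comm A : A *m S = S *m A -> A *m G = G *m A.
Proof.
move=> AS; have AS1 : A *m (S + 1%:M) = (S + 1%:M) *m A.
  by rewrite mulmxDl mulmxDr AS mulmx1 mul1mx.
by rewrite -[LHS]mul1mx -GS -mulmxA [X in G *m X]mulmxA -AS1 -mulmxA SG mulmx1.
Qed.

(** By idempotence [Q - 1%:M] annihilates [Q *m Q ^t* = S *m S], hence [S]. *)
Let QS : Q *m S = S.
Proof.
apply/eqP; rewrite -subr_eq0 -{2}[S]mul1mx -mulmxBl; apply/eqP.
apply: mulmx_gram_eq0.
by rewrite Sh SS mulmxBl mul1mx mulmxA hQ subrr.
Qed.

Let SQ : S *m Q ^t* = S.
Proof. by rewrite -{1}Sh -trmxC_mul QS. Qed.

(** [S *m T] is the orthogonal projection onto the range of [S]; it fixes [S *m S = Q *m Q ^t*],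
    hence [Q]. *)
Let STQ : S *m T *m Q = Q.
Proof.
apply/eqP; rewrite -subr_eq0 -{2}[Q]mul1mx -mulmxBl; apply/eqP.
apply: mulmx_gram_eq0.
by rewrite -SS mulmxBl mul1mx mulmxA STS subrr.
Qed.

Let STV : S *m T *m V = V.
Proof. by rewrite mulmxDr STS STQ. Qed.

Let Vh : V ^t* = S + Q ^t*. Proof. by rewrite trmxCD Sh. Qed.

(** * The matched projection is a projection *)

Let ME : M = 2^-1 *: (V ^t* *m T *m G *m V). Proof. by rewrite Vh. Qed.

Let VV : V *m V ^t* = 2 *: (S *m (S + 1%:M)).
Proof.
rewrite Vh mulmxDl !mulmxDr QS SQ -SS mulmx1 scaler_nat mulr2n.
by rewrite [S + _]addrC.
Qed.

(** [T] and [G] cancel the factors of [V *m V ^t*] up to [S *m T], which fixes [V]. As [V] is the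
    last factor of [M], this also yields the idempotence of [M]. *)
Let VM : V *m M = V.
Proof.
rewrite ME -scalemxAr !mulmxA VV -!scalemxAl scalerA mulVf ?pnatr_eq0 // scale1r.
rewrite -(mulmxA (_ *m _) T G) (G_comm T) ?ST // mulmxA -(mulmxA S) SG mulmx1.
exact: STV.
Qed.

Let Mh : M ^t* = M.
Proof.
rewrite ME linearZ /= map_mxZ !trmxC_mul trmxCK Gh Th /= !mulmxA.
(* The adjoint reverses [T *m G]; the order is restored because [T] commutes with [S], hence with
   [G]. *)
rewrite -(mulmxA (V ^t*) G T) -(G_comm T) ?ST // !mulmxA.
by rewrite fmorphV rmorph_nat.
Qed.

Let MM : M *m M = M.
Proof. by rewrite {1}ME -scalemxAl -!mulmxA VM !mulmxA -ME. Qed.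

Let Nproj : projection_mx N.
Proof.
split; first by rewrite trmxCB trmxC1 Mh.
by rewrite mulmxBl mul1mx mulmxBr mulmx1 MM subrr subr0.
Qed.

(** * Action of [H] on the ranges of [M] and [N] *)

Let VN : V *m N = 0. Proof. by rewrite mulmxBr mulmx1 VM subrr. Qed.

(** An intertwining relation: on the range of [V ^t*], which is that of [M], [H] acts through the
    positive semi-definite [S]. *)
Let HVh : H *m V ^t* = V ^t* *m S.
Proof.
have QQ : Q ^t* *m Q ^t* = Q ^t* by rewrite -trmxC_mul hQ.
rewrite Vh mulmxBl !mulmxDl !mulmxDr !mul1mx QS QQ -SS.
apply/eqP; rewrite subr_eq; apply/eqP.
by rewrite addrAC addrC -!addrA; congr (_ + _); rewrite addrCA.
Qed.

Let HM : H *m M = 2^-1 *: (V ^t* *m G *m V).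
Proof.
rewrite ME -scalemxAr !mulmxA HVh -(mulmxA _ S) -(mulmxA _ (S *m T)) (G_comm (S *m T)).
  by rewrite mulmxA -(mulmxA _ (S *m T)) STV.
by rewrite STS ST mulmxA STS.
Qed.

(** Because [V *m N = 0], both [Q] and its adjoint act as [- S] between two copies of [N], so [H]
    becomes [- (2 *: S + 1%:M)] there. *)
Let NHN : N *m H *m N = - (2 *: (N *m S *m N) + N).
Proof.
have [Nh NN] := Nproj.
have QN : Q *m N = - (S *m N).
  by apply/eqP; rewrite -addr_eq0 addrC -mulmxDl VN.
have NQ : N *m Q ^t* = - (N *m S).
  by rewrite -{1}Nh -trmxC_mul QN linearN /= map_mxN trmxC_mul Nh Sh.
rewrite [N *m H]mulmxBr mulmx1 mulmxBl NN [N *m (_ + _)]mulmxDr mulmxDl NQ -[N *m Q *m N]mulmxA QN.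
by rewrite mulmxN mulNmx mulmxA scaler_nat mulr2n !opprD.
Qed.

Let HMh : (H *m M) ^t* = H *m M.
Proof.
rewrite HM linearZ /= map_mxZ !trmxC_mul trmxCK Gh mulmxA.
by rewrite /= fmorphV rmorph_nat.
Qed.

(** Hermitian matrices with a Hermitian product commute. Hence [H] commutes with [N] too, and
    [N *m H *m N] reduces to [H *m N]. *)
Let HMC : H *m M = M *m H.
Proof.
rewrite -HMh trmxC_mul Mh /H trmxCB trmxCD trmxCK trmxC1.
by rewrite [_ + Q]addrC.
Qed.

Let HN : H *m N = - (2 *: (N *m S *m N) + N).
Proof.
rewrite -NHN; have [_ {1}<-] := Nproj; rewrite mulmxA; congr (_ *m _).
by rewrite [H *m N]mulmxBr mulmx1 [N *m H]mulmxBl mul1mx HMC.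
Qed.

(** * Comparison of the norms and the equality case *)

(** As [G] inverts [S + 1%:M], the [Y] terms are the trace of [V ^t* *m G *m V *m P], twice that of
    [H *m M *m P]; the [Z] terms are the trace of [- (H *m N) *m (1%:M - P)]. Keeping the Gram
    traces separate from those with [S] makes equality force [Y = 0] and [Z = 0]. *)
Lemma frobenius_norm_matched_projectionB (P : 'M[C]_n) (hP : projection_mx P)
    (Y := G *m V *m P) (Z := N *m (1%:M - P)) :
  frobenius_norm (N - Q) ^+ 2 - frobenius_norm (P - Q) ^+ 2 =
    2^-1 * (\tr (Y ^t* *m S *m Y) + \tr (Y ^t* *m Y))
      + (2 * \tr (Z ^t* *m S *m Z) + \tr (Z ^t* *m Z)).
Proof.
have [[Nh NN] [Ph PP]] := (Nproj, hP).
rewrite !frobenius_norm_projB // -/H.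
have trY : \tr (Y ^t* *m S *m Y) + \tr (Y ^t* *m Y)
    = \tr (V ^t* *m G *m V *m P).
  rewrite -linearD /= -{2}[Y ^t*]mulmx1 -mulmxDl -mulmxDr /Y !trmxC_mul Gh Ph.
  rewrite !mulmxA -(mulmxA _ (S + 1%:M)) SG mulmx1.
  by rewrite [LHS]mxtrace_mulC [RHS]mxtrace_mulC !mulmxA PP.
have P'h : (1%:M - P) ^t* = 1%:M - P by rewrite trmxCB trmxC1 Ph.
have P'P' : (1%:M - P) *m (1%:M - P) = 1%:M - P.
  by rewrite mulmxBl mul1mx mulmxBr mulmx1 PP subrr subr0.
(* Cyclicity of the trace merges the two outer factors [1%:M - P] into one. *)
have trZ A : \tr (Z ^t* *m A *m Z) = \tr (N *m A *m N *m (1%:M - P)).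
  rewrite /Z trmxC_mul Nh P'h mulmxA mxtrace_mulC !mulmxA P'P'.
  by rewrite [RHS]mxtrace_mulC !mulmxA.
have trZ1 : \tr (Z ^t* *m Z) = \tr (N *m (1%:M - P)).
  by rewrite -[Z ^t*]mulmx1 trZ mulmx1 NN.
have trHP : \tr (H *m P) = \tr (H *m M *m P) + \tr (H *m N *m P).
  by rewrite -mxtraceD -mulmxDl -mulmxDr /N addrC subrK mulmx1.
have trHN : 2 * \tr (N *m S *m N *m (1%:M - P)) + \tr (N *m (1%:M - P))
    = \tr (H *m N *m P) - \tr (H *m N).
  rewrite -mxtraceZ (scalemxAl _ _ (1%:M - P)) -mxtraceD -mulmxDl.
  rewrite -[_ + N]opprK -HN mulNmx (mulmxBr (H *m N)) mulmx1 opprB.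
  exact: linearB.
rewrite trY trZ trZ1 trHN -mxtraceZ (scalemxAl _ _ P) -HM trHP.
by ring.
Qed.

Lemma frobenius_norm_matched_projection_le (P : 'M[C]_n) : projection_mx P ->
  frobenius_norm (P - Q) <= frobenius_norm (N - Q).
Proof.
move=> hP; rewrite -(@ler_pXn2r _ 2) ?nnegrE ?frobenius_norm_ge0 //.
rewrite -subr_ge0 frobenius_norm_matched_projectionB //.
by rewrite addr_ge0 ?mulr_ge0 ?addr_ge0 ?invr_ge0 ?ler0n ?mulr_ge0
  ?mxtrace_psd_ge0 ?mxtrace_gram_ge0.
Qed.

Lemma frobenius_norm_matched_projection_eq (P : 'M[C]_n) : projection_mx P ->
  frobenius_norm (P - Q) = frobenius_norm (N - Q) -> P = N.
Proof.
move=> hP eqF; have := frobenius_norm_matched_projectionB P hP.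
rewrite eqF subrr => /esym/eqP.
rewrite paddr_eq0 ?mulr_ge0 ?addr_ge0 ?invr_ge0 ?ler0n ?mulr_ge0
  ?mxtrace_psd_ge0 ?mxtrace_gram_ge0 //.
rewrite mulf_eq0 invr_eq0 pnatr_eq0 /= => /andP[].
rewrite !paddr_eq0 ?mulr_ge0 ?ler0n ?mxtrace_psd_ge0 ?mxtrace_gram_ge0 //.
move=> /andP[_ /eqP/mxtrace_gram_eq0 Y0] /andP[_ /eqP/mxtrace_gram_eq0 Z0].
(* Multiplying [Y = 0] by [S + 1%:M] removes [G]. *)
have VP : V *m P = 0.
  by rewrite -[V]mul1mx -SG -!mulmxA [G *m _]mulmxA Y0 mulmx0.
have MP : M *m P = 0 by rewrite ME -scalemxAl -mulmxA VP mulmx0 scaler0.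
(* [M *m P = 0] says [N *m P = P], while [Z = 0] says [N *m P = N]. *)
move: Z0; rewrite mulmxBr mulmx1 mulmxBl mul1mx MP subr0 => /eqP.
by rewrite subr_eq0 => /eqP.
Qed.

End MatchedProjection.

Theorem theorem4p2 (R : realType) (n : nat) (hn : (0 < n)%N)
    (Q P : 'M[R[i]]_n) (hQ : idempotent_mx Q) (hP : projection_mx P) :
  frobenius_norm (P - Q)
    <= frobenius_norm (1%:M - matched_projection Q - Q) /\
  (frobenius_norm (P - Q)
     = frobenius_norm (1%:M - matched_projection Q - Q) ->
   P = 1%:M - matched_projection Q).
Proof.
split; first exact: frobenius_norm_matched_projection_le.
exact: frobenius_norm_matched_projection_eq.
Qed.
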